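(* Let $k,n>0$, $\tau>0$, $C_{max}>C_{min}>0$, $v_{max}>v_{min}>0$, $L\in[v_{min}\tau,v_{max}\tau]$, $\overline{C}\in[C_{min},C_{max}]$, $\overline{v}\in[v_{min},v_{max}]$ be given, and assume $C_{min}\le\frac{\overline{C}\,\overline{v}\,\tau}{L}\le C_{max}$. Let the class of admissible controls $\mathcal{V}_\tau$, the class of bang-bang controls $\mathcal{B}_\tau$ and the cost $J$ be as defined in the context. 1) If $n=1$, then $J[C_{A_0},v]=\overline{C}\,\overline{v}\,e^{-k\tau}$ for all $(C_{A_0},v)\in\mathcal{V}_\tau$. 2) If $n>1$, then the controls of the class $\mathcal{B}_\tau$ are optimal: every $(c,v)\in\mathcal{B}_\tau$ minimizes $J$ over $\mathcal{V}_\tau$.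
   Context: Model: $\frac{\partial C_A}{\partial t}+v(t)\frac{\partial C_A}{\partial x}+kC_A^n=0$ on $[0,L]\times\mathbb{R}$, $C_A(0,t)=C_{A_0}(t)$, with two controls $C_{A_0}$ and $v$. Let $V(t)=\int_0^t v(\xi)\,d\xi$ ($t\in\mathbb{R}$), a strictly increasing function with inverse $V^{-1}$. The (weak) solution corresponding to $(C_{A_0},v)$ is by definition $$C_A(x,t)=\left[C_{A_0}(r)^{-(n-1)}+k(n-1)(t-r)\right]^{-\frac{1}{n-1}}\ (n\ne1),\qquad C_A(x,t)=C_{A_0}(r)\,e^{-k(t-r)}\ (n=1),$$ where $r=V^{-1}(V(t)-x)$. The cost is $J[C_{A_0},v]=\frac1\tau\int_0^\tau C_A(L,t)\,v(t)\,dt$. The class $\mathcal{V}_\tau$ consists of all measurable $\tau$-periodic $(c,v):\mathbb{R}\to[C_{min},C_{max}]\times[v_{min},v_{max}]$ with $\frac1\tau\int_0^\tau c(t)v(t)\,dt=\overline{C}\,\overline{v}$ and $\int_0^\tau v(t)\,dt=L$. Let $\mu$ be Lebesgue measure. The class $\mathcal{B}_\tau$ consists of those $(c,v)\in\mathcal{V}_\tau$ for which, on $[0,\tau)$: $v=v_{min}$ on $B^-$ and $v=v_{max}$ on $B^+$; $c=C_{max}$ on $A^+$ and $c=C_{min}$ on $A^-$; here $A^\pm,B^\pm\subset[0,\tau)$ are measurable, $\mu(B^+\cap B^-)=\mu(A^+\cap A^-)=0$, $\mu(B^+\cup B^-)=\mu(A^+\cup A^-)=\tau$, $\mu(B^+)=\mu_v^+:=\frac{L-\tau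 v_{min}}{v_{max}-v_{min}}$, $\mu(B^-)=\mu_v^-:=\frac{\tau v_{max}-L}{v_{max}-v_{min}}$, and $A^+\cap B^-$ has the maximum measure among all such choices consistent with $\frac1\tau\int_0^\tau c\,v\,dt=\overline{C}\,\overline{v}$. Concretely, with $$\kappa:=\tau v_{max}(\overline{C}\,\overline{v}-C_{max}v_{min})+\tau v_{min}(C_{min}v_{max}-\overline{C}\,\overline{v})+L(C_{max}v_{min}-C_{min}v_{max}):$$ (i) if $\kappa\le0$, then $\mu(A^+)\le\mu(B^-)$, $A^+\cap B^+=\emptyset$, $\mu(A^+)=\mu_c^+:=\frac{\tau\overline{C}\,\overline{v}-LC_{min}}{v_{min}(C_{max}-C_{min})}$ and $\mu(A^-)=\mu_c^-:=\tau-\mu_c^+$; (ii) if $\kappa>0$, then $\mu(A^-)\le\mu(B^+)$, $A^-\cap B^-=\emptyset$, $\mu(A^-)=\mu_c^-:=\frac{LC_{max}-\tau\overline{C}\,\overline{v}}{v_{max}(C_{max}-C_{min})}$ and $\mu(A^+)=\mu_c^+:=\tau-\mu_c^-$. *)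

(* Defs.v *)
From HB Require Import structures.
From mathcomp Require Import all_boot all_order all_algebra.
From mathcomp Require Import all_classical all_reals all_analysis.

Set Implicit Arguments.
Unset Strict Implicit.
Unset Printing Implicit Defensive.

Import Order.TTheory GRing.Theory Num.Theory.
Import numFieldNormedType.Exports.

Local Open Scope classical_set_scope.
Local Open Scope ring_scope.

(* The real line with the sigma-algebra of Lebesgue-measurable sets, i.e. the
   domain of completed_lebesgue_measure; the canonical structure of R itself
   only carries the Borel sets. Codomains keep the Borel sigma-algebra. *)
Notation lebR R := (caratheodory_type (@wlength R idfun)^*%mu).

Definition leb (R : realType) : {measure set (lebR R) -> \bar R} :=
  @completed_lebesgue_measure R.

Section Reactor.
Context {R : realType}.
Implicit Types c v f : R -> R.

Local Notation mu := (leb R).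

Definition lebesgue_measurable f : Prop := measurable_fun [set: lebR R] f.

Definition integral_from_to (a b : R) f : R :=
  if a <= b then Rintegral mu `[a, b] f else - Rintegral mu `[b, a] f.

Definition V v (t : R) : R := integral_from_to 0 t v.

(* When n < 1 the bracket may be negative (the reactant is exhausted); powR
   then returns a junk value. *)
Definition C_A (k n : R) c v (x t : R) : R :=
  let r := pinv [set: R] (V v) (V v t - x) in
  if n == 1 then c r * expR (- (k * (t - r)))
  else (c r `^ (- (n - 1)) + k * (n - 1) * (t - r)) `^ (- (n - 1)^-1).

Definition J (k n tau L : R) c v : R :=
  tau^-1 * integral_from_to 0 tau (fun t => C_A k n c v L t * v t).

Record admissible (tau L Cmin Cmax vmin vmax Cbar vbar : R) c v : Prop := {
  adm_meas_c : lebesgue_measurable c;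
  adm_meas_v : lebesgue_measurable v;
  adm_per_c : periodic c tau;
  adm_per_v : periodic v tau;
  adm_range_c : forall t, Cmin <= c t <= Cmax;
  adm_range_v : forall t, vmin <= v t <= vmax;
  adm_mean_cv :
    tau^-1 * integral_from_to 0 tau (fun t => c t * v t) = Cbar * vbar;
  adm_int_v : integral_from_to 0 tau v = L }.

Record bang_bang_sets (tau L Cmin Cmax vmin vmax : R) c v
    (Ap Am Bp Bm : set (lebR R)) : Prop := {
  bb_meas : [/\ measurable Ap, measurable Am, measurable Bp & measurable Bm];
  bb_sub : [/\ Ap `<=` `[0, tau[, Am `<=` `[0, tau[,
               Bp `<=` `[0, tau[ & Bm `<=` `[0, tau[];
  bb_v_min : forall t, Bm t -> v t = vmin;
  bb_v_max : forall t, Bp t -> v t = vmax;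
  bb_c_max : forall t, Ap t -> c t = Cmax;
  bb_c_min : forall t, Am t -> c t = Cmin;
  bb_B_overlap : mu (Bp `&` Bm) = 0%E;
  bb_A_overlap : mu (Ap `&` Am) = 0%E;
  bb_B_cover : mu (Bp `|` Bm) = tau%:E;
  bb_A_cover : mu (Ap `|` Am) = tau%:E;
  bb_mu_Bp : mu Bp = ((L - tau * vmin) / (vmax - vmin))%:E;
  bb_mu_Bm : mu Bm = ((tau * vmax - L) / (vmax - vmin))%:E }.

Definition kappa (tau L Cmin Cmax vmin vmax Cbar vbar : R) : R :=
  tau * vmax * (Cbar * vbar - Cmax * vmin)
  + tau * vmin * (Cmin * vmax - Cbar * vbar)
  + L * (Cmax * vmin - Cmin * vmax).

(* bbc_max asks that A^+ \cap B^- have the maximum measure among all bang-bang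
   choices compatible with the constraints; bbc_i and bbc_ii spell out the
   configurations in which this maximum is attained. *)
Record bang_bang_maximal (tau L Cmin Cmax vmin vmax Cbar vbar : R) c v
    (Ap Am Bp Bm : set (lebR R)) : Prop := {
  bbc_sets : bang_bang_sets tau L Cmin Cmax vmin vmax c v Ap Am Bp Bm;
  bbc_max : forall c' v' Ap' Am' Bp' Bm',
    admissible tau L Cmin Cmax vmin vmax Cbar vbar c' v' ->
    bang_bang_sets tau L Cmin Cmax vmin vmax c' v' Ap' Am' Bp' Bm' ->
    (mu (Ap' `&` Bm') <= mu (Ap `&` Bm))%E;
  bbc_i : kappa tau L Cmin Cmax vmin vmax Cbar vbar <= 0 ->
    let mu_c_p :=
      (tau * (Cbar * vbar) - L * Cmin) / (vmin * (Cmax - Cmin)) in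
    [/\ (mu Ap <= mu Bm)%E, Ap `&` Bp = set0,
        mu Ap = mu_c_p%:E & mu Am = (tau - mu_c_p)%:E];
  bbc_ii : 0 < kappa tau L Cmin Cmax vmin vmax Cbar vbar ->
    let mu_c_m :=
      (L * Cmax - tau * (Cbar * vbar)) / (vmax * (Cmax - Cmin)) in
    [/\ (mu Am <= mu Bp)%E, Am `&` Bm = set0,
        mu Am = mu_c_m%:E & mu Ap = (tau - mu_c_m)%:E] }.

Definition bang_bang (tau L Cmin Cmax vmin vmax Cbar vbar : R) c v : Prop :=
  admissible tau L Cmin Cmax vmin vmax Cbar vbar c v /\
  exists Ap Am Bp Bm,
    bang_bang_maximal tau L Cmin Cmax vmin vmax Cbar vbar c v Ap Am Bp Bm.

Definition minimizes_J (k n tau L Cmin Cmax vmin vmax Cbar vbar : R) c v :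
    Prop :=
  admissible tau L Cmin Cmax vmin vmax Cbar vbar c v /\
  forall c' v', admissible tau L Cmin Cmax vmin vmax Cbar vbar c' v' ->
    J k n tau L c v <= J k n tau L c' v'.

End Reactor.

(* Main.v *)
Require Import Defs.
From mathcomp Require Import all_boot all_order all_algebra.
From mathcomp Require Import all_classical all_reals all_analysis.
From mathcomp Require Import measurable_realfun ring.

Import Order.TTheory GRing.Theory Num.Theory.
Import numFieldNormedType.Exports.

Local Open Scope classical_set_scope.
Local Open Scope ring_scope.

(* Since v is tau-periodic with integral L over a period, the residence time in
   the reactor is always tau: r = t - tau. By periodicity of c, the outlet
   concentration is therefore phi (c t) with
   phi x = (x^(-(n-1)) + k (n-1) tau)^(-1/(n-1)) (and x e^(-k tau) for n = 1,
   where the cost is immediate). For n > 1, phi is concave, so it lies above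
   its chord over [Cmin, Cmax]. The v-weighted mean of the chord is the same
   for all admissible controls, and it is attained as soon as c takes almost
   everywhere only the values Cmin and Cmax. *)

(** * Translation invariance of the completed Lebesgue measure *)

Section LebesgueTranslation.
Context {R : realType}.
Implicit Types (a : R) (X : set R).

Local Notation outer := ((@wlength R idfun)^*%mu).

(** The outer measure is an infimum over countable covers by half-open intervals. Translating a
    cover of [X] by [- a] gives a cover of the preimage with the same total length. *)
Lemma outer_shift_le a X : (outer (+%R a @^-1` X) <= outer X)%E.
Proof.
apply: le_ereal_inf_tmp => _ [A [mA XA] <-].
apply: ereal_inf_lbound; exists (fun k => +%R a @^-1` A k).
  split; last by move=> x /XA[k _ Ak]; exists k.
  move=> k; have [[x y] _ /= <-] := mA k.
  exists (x - a, y - a) => //=; apply/seteqP; split => z /=;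
  by rewrite !in_itv/= ltrBlDl lerBrDl.
congr (limn _); apply/funext => n; apply: eq_bigr => k _.
have [[x y] _ /= <-] := mA k.
rewrite (_ : _ @^-1` _ = `]x - a, y - a]%classic).
  rewrite !wlength_itv/= !lte_fin ltrD2r.
  by case: ifPn => //; rewrite -!EFinB opprB addrA subrK.
by apply/seteqP; split => z /=; rewrite !in_itv/= ltrBlDl lerBrDl.
Qed.

Lemma outer_shift a X : outer (+%R a @^-1` X) = outer X.
Proof.
apply/eqP; rewrite eq_le outer_shift_le/=.
rewrite [leLHS](_ : _ = outer (+%R (- a) @^-1` (+%R a @^-1` X))).
  exact: outer_shift_le.
by congr (outer _); apply/seteqP; split=> x /=; rewrite addNKr.
Qed.

Lemma leb_shift a (A : set (lebR R)) : leb R (+%R a @^-1` A) = leb R A.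
Proof. exact: outer_shift. Qed.

(** The sets at stake need not be Borel, so continuity of the translation is not enough. Instead
    Carathéodory's condition is transported: each test set [X] is the preimage of a translated test
    set, and the outer measure is translation invariant. *)
Lemma measurable_shift a :
  measurable_fun [set: lebR R] (+%R a : lebR R -> lebR R).
Proof.
have caraE A : measurable (A : set (lebR R)) = forall X,
    outer X = (outer (X `&` A) + outer (X `&` ~` A))%E by [].
move=> _ A; rewrite setTI !caraE => mA X.
have -> : X = +%R a @^-1` (+%R (- a) @^-1` X).
  by apply/seteqP; split => x /=; rewrite addKr.
by rewrite preimage_setC -!preimage_setI !(outer_shift a); exact: mA.
Qed.

Lemma measurable_leb_itv (i : interval R) :
  measurable ([set` i] : set (lebR R)).
Proof. by apply: sub_caratheodory; exact: (@measurable_itv R i). Qed.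

Lemma leb_itv (i : interval R) :
  leb R [set` i] = (if i.1 < i.2 then (i.2 : \bar R) - i.1 else 0)%E.
Proof. exact: lebesgue_measure_itv. Qed.

Lemma leb_set1 (x : R) : leb R [set x] = 0%E.
Proof. exact: lebesgue_measure_set1. Qed.

End LebesgueTranslation.

(** * Integrals over intervals and the function [V] *)

Section IntervalIntegral.
Context {R : realType}.
Implicit Types (f v : R -> R) (a b h m M s t x : R).

Local Notation mu := (leb R).

Lemma bounded_integrable_leb f M a b : lebesgue_measurable f ->
  (forall x, `|f x| <= M) -> mu.-integrable `[a, b] (EFin \o f).
Proof.
move=> mf fM; apply: measurable_bounded_integrable.
- exact: measurable_leb_itv.
- by rewrite leb_itv/=; case: ifPn => // _; rewrite -EFinB ltry.
- exact: measurable_funTS.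
- exists M; split; first exact: num_real.
  by move=> y My x _; exact: le_trans (fM x) (ltW My).
Qed.

Lemma Rintegral_itv_split f M a b c : lebesgue_measurable f ->
    (forall x, `|f x| <= M) -> a <= b -> b <= c ->
  Rintegral mu `[a, c] f = Rintegral mu `[a, b] f + Rintegral mu `[b, c] f.
Proof.
move=> mf fM ab bc.
have fI x y := bounded_integrable_leb f M x y mf fM.
have mb : measurable ([set b] : set (lebR R)).
  by rewrite -set_itv1; exact: measurable_leb_itv.
have mI x y : measurable (`[x, y] : set (lebR R)) by exact: measurable_leb_itv.
(* The closed intervals share the point [b]; deleting this null set from the second makes the union
   disjoint. *)
have -> : Rintegral mu `[b, c] f = Rintegral mu (`[b, c] `\ b) f.
  by congr fine; apply: negligible_integral => //; exact: leb_set1.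
have acE : (`[a, c] = `[a, b] `|` (`[b, c] `\ b) :> set R)%classic.
  apply/seteqP; split => x /=; rewrite !in_itv/=.
    move=> /andP[ax xc]; have [xb|bx] := leP x b; first by left; rewrite ax.
    by right; rewrite (ltW bx) xc; split => //; apply/eqP; rewrite gt_eqF.
  move=> [/andP[-> xb]|[/andP[bx ->] _]]; first exact: le_trans xb bc.
  by rewrite (le_trans ab bx).
rewrite acE Rintegral_setU//.
- exact: measurableD.
- by rewrite -acE.
- apply/disj_setPS => x [] /=; rewrite !in_itv/= => /andP[_ xb] [/andP[bx _]].
  by apply; apply/eqP; rewrite eq_le xb.
Qed.

(** Change of variables: the pushforward of [mu] under a translation is [mu] itself. *)
Lemma Rintegral_itv_shift f M a b h : lebesgue_measurable f ->
    (forall x, `|f x| <= M) ->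
  Rintegral mu `[h + a, h + b] f = Rintegral mu `[a, b] (fun x => f (h + x)).
Proof.
move=> mf fM; congr fine.
pose S : lebR R -> lebR R := +%R h.
have mS : measurable_fun [set: lebR R] S := measurable_shift h.
transitivity
  (\int[pushforward mu S]_(x in `[(h + a)%R, (h + b)%R]) (f x)%:E)%E.
  by apply: eq_measure_integral => A mA _; exact/esym/leb_shift.
have preE : (S @^-1` `[h + a, h + b] = `[a, b] :> set R)%classic.
  by apply/seteqP; split=> x /=; rewrite !in_itv/= !lerD2l.
rewrite integral_pushforward ?preE//.
- exact/measurable_EFinP.
- apply: (bounded_integrable_leb _ M) => //.
  exact: (measurableT_comp mf).
- exact: measurable_leb_itv.
Qed.

(** Chasles' relation; the cases on the signs of [s] and [t] come from the orientation built into
    [integral_from_to]. *)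
Lemma V_sub v M s t : lebesgue_measurable v -> (forall x, `|v x| <= M) ->
  s <= t -> V v t - V v s = Rintegral mu `[s, t] v.
Proof.
move=> mv vM st; rewrite /V /integral_from_to.
have split3 := Rintegral_itv_split v M _ _ _ mv vM.
have [t0|t0] := leP 0 t; have [s0|s0] := leP 0 s.
- by rewrite (split3 0 s t)// addrAC subrr add0r.
- by rewrite opprK addrC -split3// ltW.
- by have := le_lt_trans st t0; rewrite ltNge s0.
- by rewrite opprK addrC (split3 s t 0)// ?(ltW t0)// addrK.
Qed.

(** The increment of [V v] over [[s, t]] is at least [m * (t - s)], so [V v] is strictly increasing.
    This makes [pinv] a genuine inverse on the range of [V v]. *)
Lemma V_inj v m M : 0 < m -> lebesgue_measurable v ->
  (forall x, m <= v x <= M) -> injective (V v).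
Proof.
move=> m0 mv vmM.
have vM x : `|v x| <= M.
  by have /andP[mvx vxM] := vmM x; rewrite ger0_norm// (le_trans (ltW m0)).
have mono s t : s < t -> V v s < V v t.
  move=> st; rewrite -subr_gt0 (V_sub v M)//; last exact: ltW.
  apply: (@lt_le_trans _ _ (Rintegral mu `[s, t] (cst m))).
    rewrite Rintegral_cst; last exact: measurable_leb_itv.
    by rewrite leb_itv/= lte_fin st -EFinB/= mulr_gt0// subr_gt0.
  apply: le_Rintegral.
  - exact: measurable_leb_itv.
  - apply: (bounded_integrable_leb _ m) => [|x]; first exact: measurable_cst.
    by rewrite ger0_norm// ltW.
  - exact: (bounded_integrable_leb _ M).
  - by move=> x _; have /andP[] := vmM x.
move=> s t VE; case: (ltgtP s t) => // /mono; by rewrite VE ltxx.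
Qed.

End IntervalIntegral.

(** * Concavity of the outlet concentration as a function of the inlet one *)

Section Concavity.
Context {R : realType}.
Implicit Types (f D : R -> R) (a b p q x y K : R).

(** The mean value theorem on [[a, x]] and on [[x, b]] gives points [s <= t], and the slope [D s] of
    the left piece is at least the slope [D t] of the right one. *)
Lemma chord_le f D a x b : a < b -> a <= x <= b ->
    (forall y, a <= y <= b -> is_derive y 1 f (D y)) ->
    (forall y z, a <= y -> y <= z -> z <= b -> D z <= D y) ->
  f a + (f b - f a) / (b - a) * (x - a) <= f x.
Proof.
move=> ab /andP[ax xb] fD Dnincr.
have cf y z : a <= y -> z <= b -> {within `[y, z], continuous f}.
  move=> ay zb; apply: derivable_within_continuous => u.
  rewrite in_itv/= => /andP[yu uz]; apply: @ex_derive; apply: fD.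
  by rewrite (le_trans ay)// (le_trans uz).
have [||s + fs] := @MVT_segment R f D a x ax _ _.
- move=> y; rewrite in_itv/= => /andP[ay yx]; apply: fD.
  by rewrite (ltW ay) (le_trans (ltW yx)).
- exact: cf.
have [||t + ft] := @MVT_segment R f D x b xb _ _.
- move=> y; rewrite in_itv/= => /andP[xy yb]; apply: fD.
  by rewrite (ltW yb) (le_trans ax (ltW xy)).
- exact: cf.
rewrite !in_itv/= => /andP[xt tb] /andP[sa sx].
have Dts : D t <= D s by apply: Dnincr => //; exact: le_trans xt.
have ba : 0 < b - a by rewrite subr_gt0.
rewrite -lerBrDl mulrAC ler_pdivrMr//.
have -> : f b - f a = D t * (b - x) + D s * (x - a) by rewrite -ft -fs; ring.
rewrite fs; move: ax xb; rewrite -subr_ge0 -(subr_ge0 x) => u0 w0.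
have -> : b - a = (b - x) + (x - a) by ring.
(* Once denominators are cleared, the gap is [(D s - D t) * (b - x) * (x - a)], a product of
   nonnegative factors. *)
rewrite -subr_ge0.
have -> : D s * (x - a) * (b - x + (x - a)) -
  (D t * (b - x) + D s * (x - a)) * (x - a) =
  (D s - D t) * ((b - x) * (x - a)) by ring.
by rewrite mulr_ge0 ?subr_ge0// mulr_ge0.
Qed.

Lemma nonincreasing_powRN q x y : 0 <= q -> 0 < x -> x <= y ->
  y `^ (- q) <= x `^ (- q).
Proof.
move=> q0 x0 xy; have y0 := lt_le_trans x0 xy.
rewrite !powRN lef_pV2 ?posrE ?powR_gt0//.
by apply: ge0_ler_powR; rewrite ?nnegrE ?(ltW x0) ?(ltW y0).
Qed.

(** This is phi with [p = n - 1] and [K = k (n - 1) tau]. *)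
Definition outlet p K x := (x `^ (- p) + K) `^ (- p^-1).

(** The chain rule yields a product of two powers; it is recast as one negative power of
    [1 + K * x ^ p], a form in which its monotonicity is visible. *)
Lemma is_derive_outlet p K x : 0 < p -> 0 < K -> 0 < x ->
  is_derive x 1 (outlet p K) ((1 + K * x `^ p) `^ (- (p^-1 + 1))).
Proof.
move=> p0 K0 x0.
have y0 : 0 < x `^ (- p) + K by rewrite addr_gt0// powR_gt0.
have D1 := is_derive1_powR (- p^-1) y0.
have D2 := is_derive1_powR (- p) x0.
have D3 : is_derive x 1 (fun x => x `^ (- p) + K) (- p * x `^ (- p - 1)).
  by rewrite -[X in is_derive _ _ _ X]addr0; exact: is_deriveD.
have -> : outlet p K = (@powR R ^~ (- p^-1)) \o (fun x => x `^ (- p) + K) by [].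
suff -> : (1 + K * x `^ p) `^ (- (p^-1 + 1)) =
   - p^-1 * (x `^ (- p) + K) `^ (- p^-1 - 1) * (- p * x `^ (- p - 1)).
  exact: is_derive1_comp.
(* This factorisation splits the single power back into the two factors of the chain rule. *)
have -> : 1 + K * x `^ p = (x `^ (- p) + K) * x `^ p.
  by rewrite mulrDl -powRD ?addNr ?powRr0// (gt_eqF x0) implybT.
rewrite powRM ?powR_ge0 ?(ltW y0)// -powRrM.
have -> : p * - (p^-1 + 1) = - p - 1 by field; rewrite gt_eqF.
have -> : - (p^-1 + 1) = - p^-1 - 1 by ring.
by field; rewrite gt_eqF.
Qed.

Lemma outlet_chord p K a b x : 0 < p -> 0 < K -> 0 < a -> a < b ->
    a <= x <= b ->
  outlet p K a + (outlet p K b - outlet p K a) / (b - a) * (x - a) <=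
  outlet p K x.
Proof.
move=> p0 K0 a0 ab axb; apply: chord_le ab axb _ _.
  by move=> y /andP[ay _]; apply: is_derive_outlet => //; exact: lt_le_trans ay.
move=> y z ay yz _.
have y0 : 0 < y by exact: lt_le_trans ay.
have pos u : 0 < 1 + K * u `^ p.
  by rewrite ltr_pwDl// mulr_ge0 ?powR_ge0// ltW.
apply: nonincreasing_powRN; rewrite ?pos ?addr_ge0 ?invr_ge0 ?(ltW p0)//.
rewrite lerD2l ler_pM2l//.
by apply: ge0_ler_powR;
  rewrite ?nnegrE ?(ltW y0) ?(ltW p0) ?(le_trans (ltW y0)).
Qed.

Lemma outlet_ge0 p K x : 0 <= outlet p K x.
Proof. exact: powR_ge0. Qed.

(** Dropping the nonnegative term [x ^ (- p)] can only increase a negative power. The bound is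
    uniform in [x] and serves integrability. *)
Lemma outlet_le p K x : 0 < p -> 0 < K -> outlet p K x <= K `^ (- p^-1).
Proof.
move=> p0 K0; apply: nonincreasing_powRN => //; first by rewrite invr_ge0 ltW.
by rewrite lerDr powR_ge0.
Qed.

Lemma measurable_outlet p K : measurable_fun [set: R] (outlet p K).
Proof.
apply: (measurableT_comp (f := @powR R ^~ (- p^-1))).
  exact: measurable_powR.
by apply: measurable_funD; [exact: measurable_powR|exact: measurable_cst].
Qed.

End Concavity.

(** * The cost of an admissible control, its lower bound and the case of equality *)

Section PeriodicControls.
Context {R : realType}.
Variables (tau L Cmin Cmax vmin vmax Cbar vbar : R).
Hypotheses (tau_gt0 : 0 < tau) (Cmin_gt0 : 0 < Cmin)
  (Cmin_lt_Cmax : Cmin < Cmax) (vmin_gt0 : 0 < vmin).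
Implicit Types (c v g : R -> R) (k n t : R).

Local Notation mu := (leb R).
Local Notation adm := (admissible tau L Cmin Cmax vmin vmax Cbar vbar).

Lemma admissible_norm_v c v t : adm c v -> `|v t| <= vmax.
Proof.
case=> _ _ _ _ _ vr _ _; have /andP[lo hi] := vr t.
by rewrite ger0_norm// (le_trans (ltW vmin_gt0)).
Qed.

Lemma V_periodic c v t : adm c v -> 0 <= t <= tau ->
  V v t - L = V v (t - tau).
Proof.
move=> av /andP[t0 ttau]; have vM x := admissible_norm_v c v x av.
case: av => _ mv _ vper _ _ _.
rewrite /integral_from_to ltW// => <-.
have shiftE : Rintegral mu `[t, tau] v = Rintegral mu `[t - tau, 0] v.
  (* The endpoints are written as [tau + (t - tau)] and [tau + 0], so that the part of the period
     after [t] can be moved back by [tau]; periodicity of [v] restores the integrand. *)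
  rewrite -[t in LHS](subrKC tau) -[tau in X in `[_, X]]addr0.
  rewrite (Rintegral_itv_shift v vmax)//; congr (Rintegral _ _ _).
  by apply/funext => x; rewrite addrC.
rewrite (Rintegral_itv_split v vmax 0 t tau)// shiftE.
rewrite -(V_sub v vmax (t - tau) 0)// ?subr_le0// -(V_sub v vmax 0 t)//.
by ring.
Qed.

(** The level [V v t - L] is the value of [V v] at [t - tau], so injectivity lets [pinv] recover
    that point. *)
Lemma delay c v t : adm c v -> 0 <= t <= tau ->
  pinv [set: R] (V v) (V v t - L) = t - tau.
Proof.
move=> av t0tau; rewrite (V_periodic c v)//.
case: av => _ mv _ _ _ vr _ _; rewrite pinvKV ?inE// => x y _ _.
exact: (V_inj v vmin vmax).
Qed.

Lemma concentration_lag c v t : adm c v -> c (t - tau) = c t.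
Proof. by case=> _ _ cper _ _ _ _ _; rewrite -(cper (t - tau)) subrK. Qed.

Lemma integrable_cv c v : adm c v ->
  mu.-integrable `[0, tau] (EFin \o (fun t => c t * v t)).
Proof.
move=> av; have [mc mv _ _ cr _ _ _] := av.
apply: (bounded_integrable_leb _ (Cmax * vmax)); first exact: measurable_funM.
move=> x; rewrite normrM ler_pM// ?(admissible_norm_v c v)//.
by have /andP[lo hi] := cr x; rewrite ger0_norm// (le_trans (ltW Cmin_gt0)).
Qed.

Lemma J1E k c v : adm c v ->
  J k 1 tau L c v = Cbar * vbar * expR (- (k * tau)).
Proof.
move=> av; rewrite -(adm_mean_cv av) /J -mulrA; congr (_ * _).
rewrite /integral_from_to ltW//.
have [mc mv _ _ cr vr _ _] := av.
rewrite -RintegralZr.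
- apply: eq_Rintegral => t; rewrite inE/= in_itv/= => t0tau.
  rewrite /C_A eqxx (delay c v)// (concentration_lag c v)//.
  by rewrite subKr mulrAC.
- exact: measurable_leb_itv.
- exact: (integrable_cv c v).
Qed.

Lemma JE k n c v : 1 < n -> adm c v ->
  J k n tau L c v = tau^-1 *
    Rintegral mu `[0, tau]
      (fun t => outlet (n - 1) (k * (n - 1) * tau) (c t) * v t).
Proof.
move=> n1 av; rewrite /J /integral_from_to ltW//; congr (_ * _).
apply: eq_Rintegral => t; rewrite inE/= in_itv/= => t0tau.
rewrite /C_A gt_eqF// (delay c v)// (concentration_lag c v)//.
by rewrite subKr.
Qed.

Lemma integrable_outlet p K c v : 0 < p -> 0 < K -> adm c v ->
  mu.-integrable `[0, tau] (EFin \o (fun t => outlet p K (c t) * v t)).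
Proof.
move=> p0 K0 av; have [mc mv _ _ _ _ _ _] := av.
apply: (bounded_integrable_leb _ (K `^ (- p^-1) * vmax)).
  apply: measurable_funM; last exact: mv.
  exact: (measurableT_comp (measurable_outlet p K) mc).
move=> x; rewrite normrM ler_pM// ?(admissible_norm_v c v)//.
by rewrite ger0_norm ?outlet_ge0// outlet_le.
Qed.

Lemma integrable_v c v : adm c v -> mu.-integrable `[0, tau] (EFin \o v).
Proof.
move=> av; apply: (bounded_integrable_leb _ vmax); first by case: av.
by move=> x; exact: (admissible_norm_v c v).
Qed.

Lemma integrable_affine A B c v : adm c v ->
  mu.-integrable `[0, tau] (EFin \o (fun t => A * v t + B * (c t * v t))).
Proof.
move=> av; have mI : measurable (`[0, tau] : set (lebR R)).
  exact: measurable_leb_itv.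
have iA : mu.-integrable `[0, tau] (EFin \o (fun t => A * v t)).
  by apply: eq_integrable (integrableZl mI A (integrable_v c v av)) => //.
have iB : mu.-integrable `[0, tau] (EFin \o (fun t => B * (c t * v t))).
  by apply: eq_integrable (integrableZl mI B (integrable_cv c v av)) => //.
by apply: eq_integrable (integrableD mI iA iB) => //.
Qed.

(** The right-hand side is free of [c] and [v] because the two integral constraints fix the means of
    [v] and of [c * v]. *)
Lemma mean_affine A B c v : adm c v ->
  tau^-1 * Rintegral mu `[0, tau] (fun t => A * v t + B * (c t * v t)) =
  A * (L / tau) + B * (Cbar * vbar).
Proof.
move=> av; have mI : measurable (`[0, tau] : set (lebR R)).
  exact: measurable_leb_itv.
have iA : mu.-integrable `[0, tau] (EFin \o (fun t => A * v t)).
  by apply: eq_integrable (integrableZl mI A (integrable_v c v av)) => //.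
have iB : mu.-integrable `[0, tau] (EFin \o (fun t => B * (c t * v t))).
  by apply: eq_integrable (integrableZl mI B (integrable_cv c v av)) => //.
rewrite RintegralD// !RintegralZl//;
  [|exact: (integrable_cv c v)|exact: (integrable_v c v)].
rewrite -(adm_mean_cv av) -[in L / tau](adm_int_v av) /integral_from_to ltW//.
by ring.
Qed.

Definition outlet_slope p K :=
  (outlet p K Cmax - outlet p K Cmin) / (Cmax - Cmin).

(* The mean over a period of the chord of [outlet p K], weighted by [v]: the
   constraints on [v] and [c * v] make it independent of the controls. *)
Definition cost_bound p K :=
  (outlet p K Cmin - outlet_slope p K * Cmin) * (L / tau) +
  outlet_slope p K * (Cbar * vbar).

Lemma J_ge k n c v : 0 < k -> 1 < n -> adm c v ->
  cost_bound (n - 1) (k * (n - 1) * tau) <= J k n tau L c v.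
Proof.
move=> k0 n1 av; have p0 : 0 < n - 1 by rewrite subr_gt0.
have K0 : 0 < k * (n - 1) * tau by rewrite !mulr_gt0.
(* Read backwards, [mean_affine] turns the constant into the mean of the chord weighted by [v], so
   the integrands can be compared pointwise, using [v >= 0]. *)
rewrite /cost_bound (JE k n c v n1 av) -(mean_affine _ _ c v av).
rewrite ler_pM2l ?invr_gt0//; apply: le_Rintegral.
- exact: measurable_leb_itv.
- exact: integrable_affine.
- exact: integrable_outlet.
- move=> t _; have := adm_range_c av t => cr; rewrite mulrA -mulrDl.
  have /andP[v0 _] := adm_range_v av t.
  rewrite ler_wpM2r ?(le_trans (ltW vmin_gt0))//.
  apply: le_trans (outlet_chord _ _ _ _ _ p0 K0 Cmin_gt0 Cmin_lt_Cmax cr).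
  by rewrite addrAC -addrA -mulrBr.
Qed.

(** A chord meets the graph at both endpoints, so the two integrands agree wherever [c] equals
    [Cmin] or [Cmax], hence almost everywhere on the period. *)
Lemma J_two_valued k n c v (Ap Am : set (lebR R)) : 0 < k -> 1 < n -> adm c v ->
    measurable Ap -> measurable Am ->
    Ap `<=` `[0, tau[ -> Am `<=` `[0, tau[ ->
    (forall t, Ap t -> c t = Cmax) -> (forall t, Am t -> c t = Cmin) ->
    mu (Ap `|` Am) = tau%:E ->
  J k n tau L c v = cost_bound (n - 1) (k * (n - 1) * tau).
Proof.
move=> k0 n1 av mAp mAm sAp sAm cAp cAm muA.
have p0 : 0 < n - 1 by rewrite subr_gt0.
have K0 : 0 < k * (n - 1) * tau by rewrite !mulr_gt0.
rewrite /cost_bound (JE k n c v n1 av) -(mean_affine _ _ c v av).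
congr (_ * fine _).
pose D : set (lebR R) := `[0, tau]%classic.
have mD : measurable D by exact: measurable_leb_itv.
have mA : measurable (Ap `|` Am) by exact: measurableU.
have sA : Ap `|` Am `<=` D.
  by move=> x [/sAp|/sAm] /=; rewrite /D/= !in_itv/= => /andP[-> /ltW].
have muD : mu D = tau%:E by rewrite leb_itv/= lte_fin tau_gt0 -EFinB subr0.
have mN : measurable (D `\` (Ap `|` Am)) by exact: measurableD.
have muN : mu (D `\` (Ap `|` Am)) = 0%E.
  transitivity (mu D - mu (D `&` (Ap `|` Am)))%E.
    by apply: measureD => //; rewrite [ltLHS]muD ltry.
  by rewrite setIidr// muA muD subee.
(* Both integrals are restricted to the complement of a null set, where every time lies in [Ap] or
   [Am]. *)
rewrite (negligible_integral mN mD (integrable_outlet _ _ c v p0 K0 av) muN).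
rewrite (negligible_integral mN mD (integrable_affine _ _ c v av) muN).
apply: eq_integral => t; rewrite inE => -[Dt nN].
have At : (Ap `|` Am) t by apply: contrapT => nA; exact: nN (conj Dt nA).
rewrite /= mulrA -mulrDl; congr (_ * _)%:E.
have [/cAp ->|/cAm ->] := At; last by rewrite subrK.
rewrite addrAC -addrA -mulrBr /outlet_slope divfK ?subrKC//.
by rewrite subr_eq0 gt_eqF.
Qed.

End PeriodicControls.

Theorem theorem3p1 (R : realType)
    (k n tau L Cmin Cmax vmin vmax Cbar vbar : R)
    (k_gt0 : 0 < k) (n_gt0 : 0 < n) (tau_gt0 : 0 < tau)
    (Cmin_gt0 : 0 < Cmin) (Cmin_lt_Cmax : Cmin < Cmax)
    (vmin_gt0 : 0 < vmin) (vmin_lt_vmax : vmin < vmax)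
    (L_range : vmin * tau <= L <= vmax * tau)
    (Cbar_range : Cmin <= Cbar <= Cmax)
    (vbar_range : vmin <= vbar <= vmax)
    (mean_range : Cmin <= Cbar * vbar * tau / L <= Cmax) :
  (n = 1 -> forall c v : R -> R,
     admissible tau L Cmin Cmax vmin vmax Cbar vbar c v ->
     J k n tau L c v = Cbar * vbar * expR (- (k * tau)))
  /\
  (1 < n -> forall c v : R -> R,
     bang_bang tau L Cmin Cmax vmin vmax Cbar vbar c v ->
     minimizes_J k n tau L Cmin Cmax vmin vmax Cbar vbar c v).
Proof.
split=> [-> c v cv|n1 c v [cv [Ap [Am [Bp [Bm [sets _ _ _]]]]]]].
  exact: J1E cv.
split=> // c' v' cv'.
have [[mAp mAm _ _] [sAp sAm _ _] _ _ cAp cAm _ _ _ muA _ _] := sets.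
(* The bang-bang control attains [cost_bound], which is a lower bound for every competitor. *)
rewrite (J_two_valued _ _ _ _ _ vmax Cbar vbar tau_gt0 Cmin_gt0 Cmin_lt_Cmax
  vmin_gt0 k n c v Ap Am)//.
exact: J_ge cv'.
Qed.
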